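(* Let $\alpha<\beta\le\alpha+2\pi$, $a\in(0,1)$, $r>0$ and $z\in\angle_*(\alpha,\beta)$. (1) If $a|z|\ge r$, then $$\omega\bigl(z,\overline D(r);\angle_*(\alpha,\beta)\bigr)\le\frac{2r^{\frac\pi{\beta-\alpha}}}{\pi\bigl(1-a^{\frac\pi{\beta-\alpha}}\bigr)^2}\left(-\operatorname{Im}\frac1{(ze^{-i\alpha})^{\frac\pi{\beta-\alpha}}}\right).$$ (2) If $ar\ge|z|$, then $$\omega\bigl(z,\mathbb C\setminus D(r);\angle_*(\alpha,\beta)\bigr)\le\frac{2r^{-\frac\pi{\beta-\alpha}}}{\pi\bigl(1-a^{\frac\pi{\beta-\alpha}}\bigr)^2}\operatorname{Im}\,(ze^{-i\alpha})^{\frac\pi{\beta-\alpha}}.$$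
   Context: $D(r)$, $\overline D(r)$ are the open and closed discs of radius $r$ centred at $0$. $\angle_*(\alpha,\beta)=\{z\ne0:\ \text{some value of }\arg z\text{ lies in }(\alpha,\beta)\}$ is the open angle; $z\mapsto(ze^{-i\alpha})^{\pi/(\beta-\alpha)}$ is taken with the branch of the power positive on the positive half-axis, mapping the angle conformally onto the upper half-plane. $\omega(z,B;\angle_*(\alpha,\beta))$ is the harmonic measure at $z$ of $B\cap\partial\angle_*(\alpha,\beta)$ for the domain $\angle_*(\alpha,\beta)$; equivalently $\omega(z,B;\angle_*(\alpha,\beta))=\frac1\pi\int_{B'}\operatorname{Im}\frac1{t-z'}\,dt$, where $z'=(ze^{-i\alpha})^{\pi/(\beta-\alpha)}$ and $B'\subset\mathbb R$ is the image of $B\cap\partial\angle_*(\alpha,\beta)$ under (the boundary extension of) this map (when $\beta-\alpha=2\pi$ both sides of the boundary ray are counted). *)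

(* Defs.v *)
From HB Require Import structures.
From mathcomp Require Import all_boot all_order all_algebra.
From mathcomp Require Import complex.
From mathcomp Require Import all_classical all_reals all_analysis.

Set Implicit Arguments.
Unset Strict Implicit.
Unset Printing Implicit Defensive.

Import Order.TTheory GRing.Theory Num.Theory.
Import numFieldNormedType.Exports.

Local Open Scope classical_set_scope.
Local Open Scope ring_scope.
Local Open Scope complex_scope.

(* The norm of R[i] is R[i]-valued; [cmod] is the same number in R. *)
Definition cmod (R : realType) (z : R[i]) : R := complex.Re `|z|.

Definition polar (R : realType) (rho theta : R) : R[i] :=
  (rho * cos theta) +i* (rho * sin theta).

(* R[i]^o is R[i] with its canonical topology (and metric). *)
Definition open_disc (R : realType) (r : R) : set R[i]^o :=
  [set z | cmod z < r].

Definition closed_disc (R : realType) (r : R) : set R[i]^o :=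
  [set z | cmod z <= r].

Definition boundary (T : topologicalType) (A : set T) : set T :=
  closure A `\` A°.

Definition open_angle (R : realType) (alpha beta : R) : set R[i]^o :=
  [set z | z != 0 /\
    exists theta, alpha < theta < beta /\ z = polar (cmod z) theta].

(* The value of arg z in the interval ]0, gamma[; it is unique when
   gamma <= 2 * pi, and meaningful only for z in [open_angle 0 gamma]. *)
Definition angle_arg (R : realType) (gamma : R) (z : R[i]) : R :=
  get [set theta | 0 < theta < gamma /\ z = polar (cmod z) theta].

(* The branch of w |-> w ^ p on [open_angle 0 gamma] which tends to positive
   values as w tends to the positive half-axis (arg w -> 0). *)
Definition angle_pow (R : realType) (gamma p : R) (w : R[i]) : R[i] :=
  polar (cmod w `^ p) (p * angle_arg gamma w).

(* z |-> (z e^{-i alpha})^{pi / (beta - alpha)}, which maps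
   [open_angle alpha beta] conformally onto the upper half-plane. *)
Definition to_halfplane (R : realType) (alpha beta : R) (z : R[i]^o) : R[i]^o :=
  angle_pow (beta - alpha) (pi / (beta - alpha)) (z * polar 1 (- alpha)).

(* The real points corresponding to the points of B lying on the boundary of
   the angle, under the boundary extension of [to_halfplane]. The boundary
   values at zeta are the limit points of [to_halfplane alpha beta z] as z tends
   to zeta inside the angle: when beta - alpha = 2 * pi, every nonzero zeta on
   the boundary ray has two of them, one for each side of the ray. *)
Definition boundary_image (R : realType) (alpha beta : R) (B : set R[i]^o) :
    set R :=
  [set t | exists2 zeta, (B `&` boundary (open_angle alpha beta)) zeta &
     cluster (to_halfplane alpha beta @
                within (open_angle alpha beta) (nbhs zeta)) (t%:C : R[i]^o)].

(* Harmonic measure at w of a Borel set E of the real line for the upper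
   half-plane. *)
Definition halfplane_harmonic_measure (R : realType) (w : R[i]) (E : set R) :
    \bar R :=
  ((pi^-1)%:E *
   \int[lebesgue_measure]_(t in E) (complex.Im (t%:C - w)^-1)%:E)%E.

(* Harmonic measure at z of B `&` boundary (open_angle alpha beta) for
   [open_angle alpha beta], transported to the upper half-plane by the conformal
   map [to_halfplane] (conformal invariance). Intended for
   alpha < beta <= alpha + 2 * pi, z in the angle and B a Borel set. *)
Definition angle_harmonic_measure (R : realType) (alpha beta : R) (z : R[i]^o)
    (B : set R[i]^o) : \bar R :=
  halfplane_harmonic_measure (to_halfplane alpha beta z)
    (boundary_image alpha beta B).

(* Main.v *)
Require Import Defs.
From HB Require Import structures.
From mathcomp Require Import all_boot all_order all_algebra.
From mathcomp Require Import complex.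
From mathcomp Require Import all_classical all_reals all_analysis.
From mathcomp Require Import measurable_realfun ring lra.
Import Order.TTheory GRing.Theory Num.Theory.
Import numFieldNormedType.Exports.
Local Open Scope classical_set_scope.
Local Open Scope ring_scope.
Local Open Scope complex_scope.

(* With p = pi / (beta - alpha), the image w of z under the conformal map
   has |w| = |z|^p, so the boundary points of modulus at most (at least) r
   go to the real points of modulus at most (at least) rho = r^p. Put q = a^p.
   If rho <= q |w|, then |t - w| >= (1 - q) |w| for |t| <= rho, and the Poisson
   kernel Im w / |t - w|^2 is at most Im w / ((1 - q) |w|)^2 on an interval of
   length 2 rho. If |w| <= q rho, then |t - w| >= (1 - q) |t| for |t| >= rho, and
   the kernel is at most Im w / ((1 - q) t)^2, where the integral of t^-2 over
   |t| >= rho is 2 / rho. *)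

Set Implicit Arguments.
Unset Strict Implicit.

(* Applied with A = [boundary_image _ _ _], whose measurability is not
   established: the integral of a nonnegative function is a supremum over the
   simple functions below it, hence monotone on arbitrary functions. *)
Lemma ge0_integral_le_superset d (T : measurableType d) (R : realType)
    (mu : {measure set T -> \bar R}) (A B : set T) (f g : T -> \bar R) :
  A `<=` B -> (forall x, A x -> 0 <= f x)%E -> (forall x, B x -> 0 <= g x)%E ->
  (forall x, A x -> f x <= g x)%E ->
  (\int[mu]_(x in A) f x <= \int[mu]_(x in B) g x)%E.
Proof.
move=> AB f0 g0 fg; rewrite !ge0_integralE//.
apply: ereal_sup_le => _ [h /= hf <-]; exists h => // x; apply: (le_trans (hf x)); rewrite /patch.
case: ifPn => [xA|_]; first by rewrite mem_set; [apply: fg|apply: AB]; exact: set_mem.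
by case: ifPn => // /set_mem/g0.
Qed.

(** * The integral of [t ^- 2] away from the origin *)

Lemma integral_sqrV_itvcy (R : realType) (rho : R) : 0 < rho ->
  (\int[lebesgue_measure]_(t in `[rho, +oo[) (t ^- 2)%:E = (rho^-1)%:E)%E.
Proof.
move=> rho0.
have gt0 (t : R) : rho <= t -> t != 0 by move=> h; rewrite gt_eqF// (lt_le_trans rho0).
have dV (t : R) : rho <= t -> derivable (fun x : R => - x^-1) t 1.
  by move=> h; apply: derivableN; apply: derivableV => //; exact: gt0.
(* The primitive [- t^-1] tends to 0 at infinity, so the integral is [0 - (- rho^-1)]. *)
rewrite (@ge0_continuous_FTC2y _ (fun t => t ^- 2) (fun t => - t^-1) rho 0).
- by rewrite sub0e -EFinN opprK.
- by move=> t _; rewrite invr_ge0 sqr_ge0.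
- apply: continuous_in_subspaceT => t; rewrite inE/= in_itv/= andbT => /gt0 t0.
  apply: cvgV; first by rewrite sqrf_eq0.
  exact: exprn_continuous.
- rewrite -oppr0; apply: cvgN; apply/gtr0_cvgV0.
    by near=> t; near: t; exact: nbhs_pinfty_gt.
  exact: cvg_id.
- by move=> t /ltW; exact: dV.
- apply: cvgN; apply: cvgV; first exact: gt0.
  exact/cvg_at_right_filter/cvg_id.
- move=> t; rewrite in_itv/= andbT => /ltW h.
  rewrite derive1E deriveN ?deriveV ?gt0// ?derive_id; last by apply: derivableV => //; exact: gt0.
  by rewrite -scaleNr opprK -[LHS]/(_ * _) mulr1.
Unshelve. all: by end_near.
Qed.

Lemma set_le_norm (R : realDomainType) (rho : R) :
  [set t | rho <= `|t|] = `]-oo, - rho] `|` `[rho, +oo[.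
Proof.
apply/seteqP; split => t /=; rewrite !in_itv/= andbT ler_normr lerNr.
  by case/orP; [right|left].
by case=> ->; rewrite ?orbT.
Qed.

Lemma continuous_sqrV_within (R : realType) (D : set R) :
  ~ D 0 -> {within D, continuous (fun t : R => t ^- 2)}.
Proof.
move=> D0; apply: continuous_in_subspaceT => t; rewrite inE => Dt.
apply: cvgV; last exact: exprn_continuous.
by rewrite sqrf_eq0; apply/eqP => t0; rewrite t0 in Dt.
Qed.

Lemma measurable_sqrV_le_norm (R : realType) (rho : R) : 0 < rho ->
  measurable_fun [set t : R | rho <= `|t|] (fun t : R => t ^- 2).
Proof.
move=> rho0; rewrite set_le_norm; apply/measurable_funU => //.
split; apply: subspace_continuous_measurable_fun => //;
  by apply: continuous_sqrV_within => /=; rewrite in_itv/=; lra.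
Qed.

Lemma integral_sqrV_le_norm (R : realType) (rho : R) : 0 < rho ->
  (\int[lebesgue_measure]_(t in [set t : R | (rho <= `|t|)%R]) (t ^- 2)%:E
   = (2 * rho^-1)%:E)%E.
Proof.
move=> rho0; have mf := measurable_sqrV_le_norm rho0.
rewrite set_le_norm in mf *.
rewrite ge0_integral_setU//=; last 3 first.
- exact/measurable_EFinP.
- by move=> t _; rewrite lee_fin invr_ge0 sqr_ge0.
- rewrite disj_set2E; apply/eqP/seteqP; split => t //=.
  by rewrite !in_itv/= andbT => -[]; lra.
(* The substitution of [- t] for [t] turns the negative ray into the positive one; each contributes
   [rho^-1]. *)
rewrite ge0_integration_by_substitutionNy//.
- under eq_integral do rewrite /= sqrrN.
  by rewrite integral_sqrV_itvcy// -EFinD mulr_natl mulr2n.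
- by apply: continuous_sqrV_within => /=; rewrite in_itv/=; lra.
- by move=> t _; rewrite invr_ge0 sqr_ge0.
Qed.

Section AngleHarmonicMeasure.
Variable R : realType.
Implicit Types z w : R[i].

(** * Real-valued modulus, polar form and the Poisson kernel *)

Lemma cmodE z : cmod z = ComplexField.Normc.normc z.
Proof. by case: z. Qed.

Lemma normCE z : `|z| = (cmod z)%:C.
Proof. by rewrite /cmod normc_def. Qed.

Lemma cmod_ge0 z : 0 <= cmod z.
Proof. by rewrite -ler0c -normCE. Qed.

Lemma cmodM z w : cmod (z * w) = cmod z * cmod w.
Proof. rewrite !cmodE; exact: ComplexField.Normc.normcM. Qed.

Lemma cmod_eq0 z : (cmod z == 0) = (z == 0).
Proof. by rewrite -[RHS]normr_eq0 normCE (inj_eq (@complexI R)). Qed.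

Lemma cmod_real (t : R) : cmod t%:C = `|t|.
Proof. by rewrite /cmod normc_def /= expr0n addr0 sqrtr_sqr. Qed.

Lemma cmod_polar (rho th : R) : 0 <= rho -> cmod (polar rho th) = rho.
Proof.
move=> h; rewrite /cmod normc_def /= !exprMn -mulrDr cos2Dsin2 mulr1 sqrtr_sqr.
by rewrite ger0_norm.
Qed.

Lemma ler_cmod_sub z w : cmod z - cmod w <= cmod (z - w).
Proof. by rewrite -lecR rmorphB /= -!normCE lerB_dist. Qed.

Lemma cmod_subC z w : cmod (z - w) = cmod (w - z).
Proof. by apply: (@complexI R); rewrite -!normCE distrC. Qed.

Lemma Im_inv z : complex.Im z^-1 = - complex.Im z / cmod z ^+ 2.
Proof.
case: z => x y; rewrite /cmod normc_def /= sqr_sqrtr ?addr_ge0 ?sqr_ge0 //.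
by rewrite mulNr.
Qed.

(** Up to the factor 1/pi this is the Poisson kernel of the upper half-plane; in this form a lower
    bound on the distance from [w] to [t] bounds it from above. *)
Lemma poisson_kernelE (t : R) w :
  complex.Im (t%:C - w)^-1 = complex.Im w / cmod (w - t%:C) ^+ 2.
Proof.
rewrite Im_inv cmod_subC; congr (_ / _).
by case: w => x y /=; rewrite sub0r opprK.
Qed.

Lemma polarM (r1 r2 t1 t2 : R) :
  polar r1 t1 * polar r2 t2 = polar (r1 * r2) (t1 + t2).
Proof.
rewrite /polar cosD sinD; apply/eqP; rewrite eq_complex /=.
by apply/andP; split; apply/eqP; ring.
Qed.

Lemma nbhs_cmod_lt z (c : R) : cmod z < c ->
  nbhs (z : R[i]^o) [set w : R[i]^o | cmod w < c].
Proof.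
move=> h; apply/nbhs_ballP; exists (c - cmod z)%:C => /=.
  by rewrite ltcR subr_gt0.
move=> w; rewrite /ball /= normCE ltcR /= => hw.
have := ler_cmod_sub w z; rewrite cmod_subC => hw'.
by lra.
Qed.

Lemma nbhs_cmod_gt z (c : R) : c < cmod z ->
  nbhs (z : R[i]^o) [set w : R[i]^o | c < cmod w].
Proof.
move=> h; apply/nbhs_ballP; exists (cmod z - c)%:C => /=.
  by rewrite ltcR subr_gt0.
move=> w; rewrite /ball /= normCE ltcR /= => hw.
have := ler_cmod_sub z w => hw'.
by lra.
Qed.

(** * The conformal map and the moduli of its boundary values *)

Lemma cmod_to_halfplane (alpha beta : R) (z : R[i]) :
  cmod (to_halfplane alpha beta z) = cmod z `^ (pi / (beta - alpha)).
Proof.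
by rewrite /to_halfplane /angle_pow cmod_polar ?powR_ge0// cmodM cmod_polar// mulr1.
Qed.

(** After rotation the argument lies in (0, beta - alpha); the power scales it into (0, pi), where
    the sine is positive. *)
Lemma Im_to_halfplane_gt0 (alpha beta : R) (z : R[i]) : alpha < beta ->
  open_angle alpha beta z -> 0 < complex.Im (to_halfplane alpha beta z).
Proof.
move=> ab [z0 [th [/andP[th1 th2] zE]]].
have ba0 : 0 < beta - alpha by rewrite subr_gt0.
rewrite /to_halfplane /angle_pow /angle_arg.
set w := z * _.
have cw : cmod w = cmod z by rewrite cmodM cmod_polar// mulr1.
have /getPex : exists theta, [set theta | 0 < theta < beta - alpha /\
    w = polar (cmod w) theta] theta.
  exists (th - alpha); split; first by apply/andP; split; lra.
  by rewrite cw /w {1}zE polarM mulr1.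
set t := get _ => -[/andP[t1 t2] _].
apply: mulr_gt0; first by rewrite powR_gt0// cw lt_def cmod_eq0 z0 cmod_ge0.
apply: sin_gt0_pi; apply/andP; split.
  by rewrite mulr_gt0// divr_gt0// pi_gt0.
rewrite mulrAC ltr_pdivrMr// ltr_pM2l//; exact: pi_gt0.
Qed.

(** The map sends modulus s to s^p, whatever the argument. If |t| differed from |zeta|^p, a modulus
    strictly between would separate the images of points near [zeta] from a neighbourhood of [t]. *)
Lemma cluster_to_halfplane (alpha beta : R) (zeta : R[i]^o) (t : R) :
  alpha < beta ->
  cluster (to_halfplane alpha beta @
     within (open_angle alpha beta) (nbhs zeta)) (t%:C : R[i]^o) ->
  `|t| = cmod zeta `^ (pi / (beta - alpha)).
Proof.
move=> ab; set p := pi / _ => cl.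
have p0 : 0 < p by rewrite divr_gt0 ?pi_gt0 ?subr_gt0.
have step (A B : set R[i]^o) : nbhs zeta A -> nbhs (t%:C : R[i]^o) B ->
    exists2 w, A w & B (to_halfplane alpha beta w).
  move=> nA nB.
  have [y [[w Aw fw] By]] : (to_halfplane alpha beta @` A `&` B) !=set0.
    apply: cl => //; rewrite /nbhs/=/within/=; near=> w => _; exists w => //.
    by near: w.
  by exists w => //; rewrite fw.
(* Taking the p-th root of |t| lets moduli be compared before the power is applied. *)
set u := `|t| `^ p^-1.
have u0 : 0 <= u by exact: powR_ge0.
have tE : `|t| = u `^ p by rewrite /u -powRrM mulVf ?gt_eqF// powRr1.
have z0 := cmod_ge0 zeta.
suff -> : cmod zeta = u by [].
apply/eqP; rewrite eq_le; apply/andP; split; rewrite leNgt; apply/negP => h.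
(* Here u < |zeta|. With [m] the midpoint, points near [zeta] have modulus above [m], while points
   near [t] have modulus below m^p; the other case is symmetric. *)
- set m := (u + cmod zeta) / 2.
  have [w /= w1] : exists2 w, m < cmod w & cmod (to_halfplane alpha beta w) < m `^ p.
    apply: (step [set w | m < cmod w] [set w | cmod w < m `^ p]).
      by apply: nbhs_cmod_gt; rewrite /m; lra.
    by apply: nbhs_cmod_lt; rewrite cmod_real tE gt0_ltr_powR ?nnegrE /m; lra.
  rewrite cmod_to_halfplane -/p ltNge => /negP; apply.
  by apply: ge0_ler_powR; rewrite ?nnegrE ?cmod_ge0 ?(ltW w1)// ?(ltW p0)// /m; lra.
- set m := (u + cmod zeta) / 2.
  have [w /= w1] : exists2 w, cmod w < m & m `^ p < cmod (to_halfplane alpha beta w).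
    apply: (step [set w | cmod w < m] [set w | m `^ p < cmod w]).
      by apply: nbhs_cmod_lt; rewrite /m; lra.
    by apply: nbhs_cmod_gt; rewrite cmod_real tE gt0_ltr_powR ?nnegrE /m; lra.
  rewrite cmod_to_halfplane -/p ltNge => /negP; apply.
  by apply: ge0_ler_powR; rewrite ?nnegrE ?cmod_ge0 ?(ltW w1)// ?(ltW p0)// /m; lra.
Unshelve. all: by end_near.
Qed.

(** * Harmonic measure estimates in the half-plane *)

Lemma poisson_kernel_ge0 (t : R) w : 0 <= complex.Im w ->
  0 <= complex.Im (t%:C - w)^-1.
Proof. by move=> w0; rewrite poisson_kernelE divr_ge0// sqr_ge0. Qed.

Lemma poisson_kernel_le (t d : R) w : 0 <= complex.Im w -> 0 < d ->
  d <= cmod (w - t%:C) -> complex.Im (t%:C - w)^-1 <= complex.Im w / d ^+ 2.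
Proof.
move=> w0 d0 dw; rewrite poisson_kernelE ler_wpM2l//.
have dw0 := lt_le_trans d0 dw.
by rewrite lef_pV2 ?posrE ?exprn_gt0// ler_sqr ?nnegrE ?(ltW d0) ?(ltW dw0).
Qed.

Lemma halfplane_harmonic_measure_near_le (rho q : R) w (E : set R) :
  0 <= rho -> q < 1 -> 0 < complex.Im w -> rho <= q * cmod w ->
  E `<=` [set t | `|t| <= rho] ->
  (halfplane_harmonic_measure w E <=
   (2 * rho / (pi * (1 - q) ^+ 2) * - complex.Im w^-1)%:E)%E.
Proof.
move=> rho0 q1 w0 rw Er; have pi0 := pi_gt0 R.
have cw0 : 0 < cmod w.
  by rewrite lt_def cmod_ge0 andbT cmod_eq0; apply: contraTneq w0 => ->; rewrite ltxx.
set d := (1 - q) * cmod w.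
have d0 : 0 < d by rewrite mulr_gt0// subr_gt0.
have -> : 2 * rho / (pi * (1 - q) ^+ 2) * - complex.Im w^-1 =
    pi^-1 * (complex.Im w / d ^+ 2 * (rho + rho)).
  rewrite Im_inv /d; field; rewrite !gt_eqF//; lra.
rewrite EFinM /halfplane_harmonic_measure lee_pmul2l// ?lte_fin ?invr_gt0//.
apply: (@le_trans _ _ (\int[lebesgue_measure]_(t in `[(- rho)%R, rho])
    (complex.Im w / d ^+ 2)%:E)%E).
  have EI : E `<=` `[- rho, rho] by move=> t /Er /=; rewrite in_itv/= -ler_norml.
  apply: ge0_integral_le_superset => // t.
  - by move=> _; rewrite lee_fin poisson_kernel_ge0// ltW.
  - by move=> _; rewrite lee_fin divr_ge0 ?sqr_ge0// ltW.
  move=> /Er /= tr; rewrite lee_fin poisson_kernel_le// ?(ltW w0)//.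
  (* |w - t| >= |w| - |t| >= |w| - rho >= (1 - q) |w|. *)
  by have := ler_cmod_sub w t%:C; rewrite cmod_real /d; lra.
rewrite integral_cst//= lebesgue_measure_itv/= lte_fin.
case: ifPn => [_|]; first by rewrite -EFinD -EFinM opprK.
(* Degenerate interval, [rho = 0]: its length is given as 0. *)
by rewrite mule0 lee_fin => _; rewrite mulr_ge0 ?addr_ge0// divr_ge0 ?sqr_ge0// ltW.
Qed.

Lemma halfplane_harmonic_measure_far_le (rho q : R) w (E : set R) :
  0 < rho -> q < 1 -> 0 < complex.Im w -> cmod w <= q * rho ->
  E `<=` [set t | rho <= `|t|] ->
  (halfplane_harmonic_measure w E <=
   (2 * rho^-1 / (pi * (1 - q) ^+ 2) * complex.Im w)%:E)%E.
Proof.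
move=> rho0 q1 w0 wr Er; have pi0 := pi_gt0 R; have cw0 := cmod_ge0 w.
have q0 : 0 <= q by rewrite -(pmulr_lge0 _ rho0) (le_trans cw0).
set k := complex.Im w / (1 - q) ^+ 2.
have k0 : 0 <= k by rewrite divr_ge0 ?sqr_ge0// ltW.
have -> : 2 * rho^-1 / (pi * (1 - q) ^+ 2) * complex.Im w =
    pi^-1 * (k * (2 * rho^-1)).
  rewrite /k; field; rewrite !gt_eqF//; lra.
rewrite EFinM /halfplane_harmonic_measure lee_pmul2l// ?lte_fin ?invr_gt0//.
rewrite EFinM -integral_sqrV_le_norm//.
rewrite -ge0_integralZl_EFin//; last 3 first.
- by rewrite set_le_norm; apply: measurableU.
- by move=> t _; rewrite lee_fin invr_ge0 sqr_ge0.
- by apply/measurable_EFinP; exact: measurable_sqrV_le_norm.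
apply: ge0_integral_le_superset => // t.
- by move=> _; rewrite lee_fin poisson_kernel_ge0// ltW.
- by move=> _; rewrite -EFinM lee_fin mulr_ge0// invr_ge0 sqr_ge0.
move=> /Er /= rt; rewrite -EFinM lee_fin.
have -> : k * t ^- 2 = complex.Im w / ((1 - q) * `|t|) ^+ 2.
  by rewrite exprMn real_normK ?num_real// [in RHS]invfM mulrA.
apply: poisson_kernel_le; first exact: ltW.
  by rewrite mulr_gt0 ?subr_gt0// (lt_le_trans rho0).
(* |t - w| >= |t| - |w| >= |t| - q rho >= (1 - q) |t|, the last step using [0 <= q]. *)
have := ler_cmod_sub t%:C w; rewrite cmod_real cmod_subC.
have : q * rho <= q * `|t| by rewrite ler_wpM2l.
lra.
Qed.

(** Discs and their complements are described by the modulus alone, so this turns membership in them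
    into a bound on |t|. *)
Lemma boundary_image_cmod (alpha beta : R) (B : set R[i]^o) (t : R) :
  alpha < beta -> boundary_image alpha beta B t ->
  exists2 zeta, B zeta & `|t| = cmod zeta `^ (pi / (beta - alpha)).
Proof. by move=> ab [zeta [Bz _] /(cluster_to_halfplane ab)]; exists zeta. Qed.

End AngleHarmonicMeasure.

Unset Implicit Arguments.
Set Strict Implicit.

Theorem mainTheorem14 (R : realType) (alpha beta a r : R) (z : R[i]^o)
  (hab : alpha < beta) (hba : beta <= alpha + 2 * pi)
  (ha : 0 < a < 1) (hr : 0 < r) (hz : open_angle alpha beta z) :
  (r <= a * cmod z ->
    (angle_harmonic_measure alpha beta z (closed_disc r) <=
     (2 * r `^ (pi / (beta - alpha))
        / (pi * (1 - a `^ (pi / (beta - alpha))) ^+ 2)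
      * - complex.Im (to_halfplane alpha beta z)^-1)%:E)%E)
  /\
  (cmod z <= a * r ->
    (angle_harmonic_measure alpha beta z (~` open_disc r) <=
     (2 * r `^ (- (pi / (beta - alpha)))
        / (pi * (1 - a `^ (pi / (beta - alpha))) ^+ 2)
      * complex.Im (to_halfplane alpha beta z))%:E)%E).
Proof.
have [a0 a1] := andP ha.
set p := pi / (beta - alpha).
have p0 : 0 < p by rewrite divr_gt0 ?pi_gt0 ?subr_gt0.
have w0 := Im_to_halfplane_gt0 hab hz.
have ap1 : a `^ p < 1.
  have : a `^ p < 1 `^ p by rewrite gt0_ltr_powR ?nnegrE ?ltW.
  by rewrite powR1.
split => [rz|zr].
(* Here rho = r^p and q = a^p; raising r <= a |z| to the power p gives rho <= q |w|. *)
- apply: halfplane_harmonic_measure_near_le => //; first exact: powR_ge0.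
    rewrite cmod_to_halfplane -powRM ?cmod_ge0 ?(ltW a0)//.
    by apply: ge0_ler_powR; rewrite ?nnegrE ?(mulr_ge0 (ltW a0)) ?cmod_ge0 ?(ltW p0) ?(ltW hr).
  move=> t /(boundary_image_cmod hab)[zeta] /= zetar ->.
  by apply: ge0_ler_powR; rewrite ?nnegrE ?cmod_ge0 ?(ltW a0) ?(ltW p0) ?(ltW hr).
(* Same rho and q, with r^(-p) read as the inverse of rho. *)
- rewrite powRN; apply: halfplane_harmonic_measure_far_le => //; first exact: powR_gt0.
    rewrite cmod_to_halfplane -powRM ?(ltW a0) ?(ltW hr)//.
    by apply: ge0_ler_powR; rewrite ?nnegrE ?(mulr_ge0 (ltW a0)) ?cmod_ge0 ?(ltW p0) ?(ltW hr).
  move=> t /(boundary_image_cmod hab)[zeta] /= /negP; rewrite -leNgt => zetar ->.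
  by apply: ge0_ler_powR; rewrite ?nnegrE ?cmod_ge0 ?(ltW a0) ?(ltW p0) ?(ltW hr).
Qed.
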